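(* If a graph $G$ has no perfect matching, then $w_{def}(G)\geq 2\delta(G)-def(G)$, where $\delta(G)$ is the minimum degree of $G$.
   Context: All graphs are finite, undirected, without loops or multiple edges. A proper $t$-edge-coloring of $G$ is a map $\alpha:E(G)\to\{1,\ldots,t\}$ such that all $t$ colors are used and adjacent edges receive different colors. The spectrum $S(v,\alpha)$ of a vertex $v$ is the set of colors on edges incident to $v$. For a finite set $A$ of integers, $def(A)=\max A-\min A-|A|+1$ ($def(\emptyset)=0$). Define $def(v,\alpha)=def(S(v,\alpha))$, $def(G,\alpha)=\sum_{v\in V(G)}def(v,\alpha)$, and $def(G)=\min_\alpha def(G,\alpha)$ over all proper edge-colorings $\alpha$ of $G$. $w_{def}(G)$ is the smallest $t$ such that $G$ has a proper $t$-edge-coloring $\alpha$ with $def(G,\alpha)=def(G)$. *)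

(* Defs.v *)
From HB Require Import structures.
From mathcomp Require Import all_boot.
From mathcomp Require Import boolp.

Set Implicit Arguments.
Unset Strict Implicit.
Unset Printing Implicit Defensive.

Record sgraph := SGraph {
  vertex :> finType;
  adj : rel vertex;
  adj_sym : symmetric adj;
  adj_irrefl : irreflexive adj
}.

Section Graph.
Variable G : sgraph.

Definition edge_set : {set {set G}} := [set [set x; y] | x in G, y in adj x].

Definition edge : finType := {e : {set G} | e \in edge_set}.

Definition edge_adj (e f : edge) : bool :=
  (e != f) && (val e :&: val f != set0).

Definition degree (v : G) : nat := #|[set w | adj v w]|.

(* Every degree is smaller than #|G|, so the default value of the minimum
   matters only for the graph without vertices. *)
Definition min_degree : nat := \big[minn/#|G|]_(v : G) degree v.

Definition matching (M : {set {set G}}) : bool :=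
  (M \subset edge_set) && trivIset M.

Definition perfect_matching (M : {set {set G}}) : bool :=
  matching M && (cover M == [set: G]).

(* The colors 1, ..., t are represented by the ordinals 0, ..., t - 1;
   deficiencies are invariant under this shift. *)
Definition proper_coloring t (a : {ffun edge -> 'I_t}) : bool :=
  [forall c, exists e, a e == c] &&
  [forall e, forall f, edge_adj e f ==> (a e != a f)].

Definition spectrum t (a : {ffun edge -> 'I_t}) (v : G) : {set 'I_t} :=
  [set a e | e : edge & v \in val e].

End Graph.

(* max A - min A - #|A| + 1, reordered so that the truncated subtractions of
   nat are exact when A is nonempty. *)
Definition set_def t (A : {set 'I_t}) : nat :=
  if A == set0 then 0
  else (\max_(i in A) i - \big[minn/t]_(i in A) i).+1 - #|A|.

Section Deficiency.
Variable G : sgraph.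

Definition vertex_def t (a : {ffun edge G -> 'I_t}) (v : G) : nat :=
  set_def (spectrum a v).

Definition coloring_def t (a : {ffun edge G -> 'I_t}) : nat :=
  \sum_(v : G) vertex_def a v.

Lemma ex_coloring_def :
  exists d, `[< exists t (a : {ffun edge G -> 'I_t}),
                  proper_coloring a /\ coloring_def a = d >].
Proof.
pose a : {ffun edge G -> 'I_#|edge G|} := [ffun e => enum_rank e].
exists (coloring_def a); apply/asboolP; exists #|edge G|, a; split=> //.
apply/andP; split.
  by apply/forallP=> c; apply/existsP; exists (enum_val c); rewrite ffunE enum_valK.
apply/forallP=> e; apply/forallP=> f; apply/implyP=> /andP[nef _].
by rewrite !ffunE (inj_eq enum_rank_inj).
Qed.

Definition graph_def : nat := ex_minn ex_coloring_def.

Lemma ex_optimal_coloring :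
  exists t, [exists a : {ffun edge G -> 'I_t},
               proper_coloring a && (coloring_def a == graph_def)].
Proof.
rewrite /graph_def; case: ex_minnP => d /asboolP[t [a [pa <-]]] _.
by exists t; apply/existsP; exists a; rewrite pa eqxx.
Qed.

Definition wdef : nat := ex_minn ex_optimal_coloring.

End Deficiency.

(* Main.v *)
(** If t colors suffice and every spectrum has at least δ elements, then every
    spectrum starts at or below color t - δ + 1 and ends at or above color δ, so
    a color of the window [t - δ + 1, δ] missing at v is counted in def(v).  If
    the 2δ - t colors of the window outnumber the total deficiency, one of them
    is missing nowhere, and its color class is a perfect matching. *)

Require Import Defs.
From mathcomp Require Import all_boot all_order all_algebra.
From mathcomp Require Import zify.

Set Implicit Arguments.
Unset Strict Implicit.
Unset Printing Implicit Defensive.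
Import GRing.Theory Num.Theory.
Local Open Scope ring_scope.

Section Bounds.
Local Open Scope nat_scope.

Lemma bigminn_leq (I : finType) (F : I -> nat) (P : pred I) n i :
  P i -> \big[minn/n]_(j | P j) F j <= F i.
Proof.
have: i \in index_enum I by rewrite mem_index_enum.
elim: (index_enum I) => // j s IHs; rewrite inE big_cons => /orP[/eqP<- ->|].
  exact: geq_minl.
move=> /IHs le_s /le_s le_i; case: ifP => // _.
exact: leq_trans (geq_minr _ _) le_i.
Qed.

Lemma card_ord_itv t m n :
  #|[set c : 'I_t | m <= c < n]| = minn n t - m.
Proof.
rewrite -sum1dep_card -(big_mkord (fun c => m <= c < n) (fun=> 1)).
elim: t => [|t IHt]; first by rewrite big_geq // minn0.
by rewrite big_mkcond big_nat_recr //= -big_mkcond /= IHt; case: ifP; lia.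
Qed.

(** With colors counted from 0, the window is [t - d <= c < d]. It lies between the extremes of [A],
    so its colors outside [A] are among the gaps that [set_def A] counts. *)
Lemma card_window_diff_set_def t d (A : {set 'I_t}) :
  0 < d <= #|A| ->
  #|[set c : 'I_t | t - d <= c < d] :\: A| <= set_def A.
Proof.
case/andP=> d_gt0 d_le; rewrite /set_def ifN; last first.
  by rewrite -card_gt0 (leq_trans d_gt0).
set C := [set c | _]; set mx := \max_(i in A) i; set mn := \big[minn/t]_(i in A) i.
have leA i : i \in A -> mn <= i <= mx.
  by move=> Ai; rewrite (bigminn_leq val) //=; apply: leq_bigmax_cond.
have bound m n : (forall i, i \in A -> m <= i < n) -> #|A| <= minn n t - m.
  move=> AP; rewrite -card_ord_itv subset_leq_card //.
  by apply/subsetP=> i Ai; rewrite inE AP.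
(* [A] fits into [[mn, t - 1]] and into [[0, mx]]; having at least [d] elements, it forces
   [mn <= t - d] and [d <= mx + 1]. *)
have mn_le : #|A| <= minn t t - mn.
  by apply: bound => i /leA/andP[-> _]; rewrite ltn_ord.
have mx_ge : #|A| <= minn mx.+1 t - 0.
  by apply: bound => i /leA/andP[_]; rewrite ltnS.
have : #|A :|: C :\: A| <= minn mx.+1 t - mn.
  rewrite -card_ord_itv subset_leq_card //; apply/subsetP=> i.
  rewrite !inE ltnS => /orP[/leA //|/andP[_ /andP[]]].
  lia.
have -> : #|A :|: C :\: A| = #|A| + #|C :\: A|.
  apply/eqP; rewrite (leq_card_setU A (C :\: A)).2 disjoint_sym.
  by rewrite -setI_eq0 setIDAC setDIl setDv setI0.
lia.
Qed.

(** Union bound: if each color were missing from some [S v], the sets of missing window colors would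
    cover the window, and the deficiencies would sum to at least its size [2 * d - t]. *)
Lemma window_color_in_all (T : finType) t d (S : T -> {set 'I_t}) :
  0 < d <= t -> (forall v, d <= #|S v|) ->
  t + \sum_(v : T) set_def (S v) < 2 * d ->
  exists c, forall v, c \in S v.
Proof.
move=> /andP[d_gt0 le_dt] leS lt_d.
have [/existsP[c /forallP cS]|/existsPn noc] :=
  boolP [exists c, [forall v, c \in S v]]; first by exists c.
exfalso.
suff : 2 * d - t <= \sum_(v : T) set_def (S v) by lia.
pose C := [set c : 'I_t | t - d <= c < d].
have <- : #|C| = 2 * d - t by rewrite card_ord_itv; lia.
apply: (@leq_trans (\sum_v #|C :\: S v|)); last first.
  by apply: leq_sum => v _; apply: card_window_diff_set_def; rewrite d_gt0 leS.
apply: (@leq_trans #|\bigcup_v (C :\: S v)|).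
  apply/subset_leq_card/subsetP=> c Cc; have := noc c.
  rewrite negb_forall => /existsP[v cNv]; apply/bigcupP; exists v => //.
  by rewrite inE cNv.
apply: (big_ind2 (fun (A : {set 'I_t}) n => #|A| <= n)) => //.
  by rewrite cards0.
move=> A m B n leA leB; apply: leq_trans (leq_card_setU A B).1 _.
exact: leq_add.
Qed.

End Bounds.

Section Coloring.
Local Open Scope nat_scope.
Variables (G : sgraph) (t : nat) (a : {ffun edge G -> 'I_t}).
Hypothesis pa : proper_coloring a.

Lemma min_degree_leq (v : G) : min_degree G <= degree v.
Proof. exact: bigminn_leq. Qed.

Lemma incident_color_inj (v : G) (e f : edge G) :
  v \in val e -> v \in val f -> a e = a f -> e = f.
Proof.
move=> ve vf eq_a; apply/eqP; apply: contraT => nef.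
have /andP[_ /forallP/(_ e)/forallP/(_ f)/implyP] := pa.
rewrite /edge_adj nef eq_a eqxx; apply.
by apply/set0Pn; exists v; rewrite inE ve.
Qed.

(** Properness gives the edges at [v] distinct colors, and [w |-> [set v; w]] sends the neighbors of
    [v] injectively to these edges, as there are no loops. *)
Lemma degree_leq_card_spectrum (v : G) : degree v <= #|spectrum a v|.
Proof.
rewrite card_in_imset; last first.
  by move=> e f; rewrite !inE; apply: incident_color_inj.
rewrite -(card_imset _ val_inj) /degree.
rewrite -(@card_in_imset _ _ (fun w => [set v; w])); last first.
  move=> w w'; rewrite !inE => vw _ eq_s.
  have : w \in [set v; w'] by rewrite -eq_s set22.
  by rewrite !inE => /orP[]/eqP // wv; rewrite wv adj_irrefl in vw.
apply/subset_leq_card/subsetP=> s /imsetP[w]; rewrite inE => vw ->.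
have eP : [set v; w] \in edge_set G by apply/imset2P; exists v w.
by apply/imsetP; exists (exist _ [set v; w] eP); rewrite // inE set21.
Qed.

(** The class covers each vertex because [c] occurs there, and two of its edges sharing a vertex
    coincide by properness. *)
Lemma full_color_class_perfect (c : 'I_t) :
  (forall v, c \in spectrum a v) ->
  perfect_matching [set val e | e : edge G & a e == c].
Proof.
move=> cP; apply/andP; split; last first.
  rewrite eqEsubset subsetT; apply/subsetP=> v _.
  have /imsetP[e ve ->] := cP v; rewrite inE in ve.
  by apply/bigcupP; exists (val e) => //; apply/imsetP; exists e; rewrite ?inE.
apply/andP; split; first by apply/subsetP=> _ /imsetP[e _ ->]; apply: valP.
apply/trivIsetP=> _ _ /imsetP[e ae ->] /imsetP[f af ->].
move: ae af; rewrite !inE => /eqP ae /eqP af; apply: contraR => /pred0Pn[v /andP[ve vf]].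
by rewrite (incident_color_inj ve vf) // ae.
Qed.

Lemma leq_min_degree_coloring_def :
  ~ (exists M : {set {set G}}, perfect_matching M) ->
  2 * min_degree G <= t + coloring_def a.
Proof.
move=> noM; rewrite leqNgt; apply/negP => lt_d; apply: noM.
have leS v : min_degree G <= #|spectrum a v|.
  exact: leq_trans (min_degree_leq v) (degree_leq_card_spectrum v).
(* Without vertices [min_degree] is its default [#|G| = 0], against [lt_d]. Otherwise the spectrum
   of a vertex [v] shows that the minimum degree is at most [t]. *)
have [v|G0] := pickP G; last first.
  by move: lt_d; rewrite /min_degree big_pred0 // eq_card0.
move=> _.
have [|c cP] := window_color_in_all _ leS lt_d.
  have : #|spectrum a v| <= t by rewrite -[leqRHS]card_ord max_card.
  by have := leS v; lia.
by exists [set val e | e : edge G & a e == c]; apply: full_color_class_perfect.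
Qed.

End Coloring.

Theorem theorem2p3 (G : sgraph) :
  ~ (exists M : {set {set G}}, perfect_matching M) ->
  (wdef G)%:Z >= 2 * (min_degree G)%:Z - (graph_def G)%:Z.
Proof.
(* The value [wdef G] is attained by a proper coloring [a] of deficiency [graph_def G], to which the
   bound for colorings applies. *)
move=> noM; rewrite /wdef; case: ex_minnP => t /existsP[a /andP[pa /eqP <-]] _.
by have := leq_min_degree_coloring_def pa noM; lia.
Qed.
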